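(* There is a universal constant $K_2 \le 61440$ such that the following holds. Let $X_1,\dots,X_n$ be independent real-valued random variables with finite second moments (not necessarily symmetric, Boolean, balanced, or identically distributed). Let $E = \mathbb{E}\sum_{i=1}^n X_i$ and $V = \operatorname{Var}\sum_{i=1}^n X_i$, and assume $V+E^2>0$. Then there exists $k \in \{1,\dots,n\}$ such that \[ \operatorname{Var}\Big|\sum_{i=1}^n X_i\Big| \;\ge\; \frac{V\cdot \operatorname{Var}\sum_{i\neq k} X_i}{K_2\,(V+E^2)}. \]
   Context: $\operatorname{Var} Z = \mathbb{E}[Z^2]-(\mathbb{E}Z)^2$ for a real random variable $Z$ with finite second moment. *)

(* Defs.v *)
From HB Require Import structures.
From mathcomp Require Import all_boot all_order all_algebra.
From mathcomp Require Import all_classical all_reals all_analysis.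
Set Implicit Arguments. Unset Strict Implicit. Unset Printing Implicit Defensive.
Import Order.TTheory GRing.Theory Num.Theory.
Local Open Scope classical_set_scope.
Local Open Scope ring_scope.

Definition mutually_independent {d} {T : measurableType d} {R : realType}
  (P : probability T R) (n : nat) (X : 'I_n -> {RV P >-> R}) : Prop :=
  forall (J : {set 'I_n}) (B : 'I_n -> set R),
    (forall i, measurable (B i)) ->
    P (\bigcap_(i in [set` J]) (X i @^-1` B i)) =
    (\prod_(i in J) P (X i @^-1` B i))%E.

Definition sumRV {d} {T : measurableType d} {R : realType} (n : nat)
  (X : 'I_n -> T -> R) : T -> R := fun w => \sum_(i < n) X i w.

Definition sumRV_but {d} {T : measurableType d} {R : realType} (n : nat)
  (X : 'I_n -> T -> R) (k : 'I_n) : T -> R := fun w => \sum_(i < n | i != k) X i w.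

(* Main.v *)
Require Import Defs.
From HB Require Import structures.
From mathcomp Require Import all_boot all_order all_algebra.
From mathcomp Require Import all_classical all_reals all_analysis measurable_realfun.
From mathcomp Require Import ring lra.
Import Order.TTheory GRing.Theory Num.Theory.
Local Open Scope ring_scope.
Set Implicit Arguments. Unset Strict Implicit. Unset Printing Implicit Defensive.

(** Split the sum as S = X + Y into two independent block sums whose variances
    are both at least a third of Var (S - X_k) for some k. Put m = E|S| and
    D = Var|S| = E (|X + Y| - m)^2.

    For any x, x', y, y', two of the four sums that share a letter have the
    same sign, so min(|x - x'|, |y - y'|)^2 is at most twice the sum of the four
    values of h(u, v) = (|u + v| - m)^2 at u in {x, x'}, v in {y, y'}. Averaging
    gives a point (x', y') at which E h(x', Y) + E h(X, y') + h(x', y') <= 3 D.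
    Let p = min((X - x')^2, 16 m^2) and q = min((Y - y')^2, 16 m^2). A
    deviation |X - x'| beyond 4 m is paid for by h, so Var X <= E p + 32 D,
    and likewise for Y, while independence and
    p q <= 16 m^2 min((X - x')^2, (Y - y')^2) give E p E q <= 128 m^2 D. Hence
    either D > min(Var X, Var Y) / 64 or
    Var X Var Y <= 512 m^2 D <= 512 (V + E^2) D. *)

(** * Pointwise inequalities for four reals and a level [m] *)

Section pointwise.
Variable R : realType.

(** Equal signs turn |a - b| into the distance between |a| and |b|. Then (s - t)^2 <= 2 (s^2 + t^2)
    with s = |a| - m and t = |b| - m, the gap being (s + t)^2. *)
Let sqr_sub_norm_same_sign (a b m : R) : 0 <= a * b ->
  (a - b) ^+ 2 <= 2 * ((`|a| - m) ^+ 2 + (`|b| - m) ^+ 2).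
Proof.
move=> ab; have -> : (a - b) ^+ 2 = (`|a| - `|b|) ^+ 2.
  by rewrite !sqrrB !real_normK ?num_real// -normrM ger0_norm.
by have := sqr_ge0 (`|a| + `|b| - 2 * m); nra.
Qed.

(* Among x+y, x+y', x'+y, x'+y' two that differ in one letter only have the
   same sign, because (x+y) + (x'+y') = (x+y') + (x'+y). *)
Lemma min_sqr_sub_le (x x' y y' m : R) :
  Num.min ((x - x') ^+ 2) ((y - y') ^+ 2) <=
  2 * ((`|x + y| - m) ^+ 2 + (`|x + y'| - m) ^+ 2 +
       (`|x' + y| - m) ^+ 2 + (`|x' + y'| - m) ^+ 2).
Proof.
have h1 := @sqr_sub_norm_same_sign (x + y) (x + y') m.
have h2 := @sqr_sub_norm_same_sign (x + y) (x' + y) m.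
have h3 := @sqr_sub_norm_same_sign (x' + y') (x + y') m.
have h4 := @sqr_sub_norm_same_sign (x' + y') (x' + y) m.
have e1 : (x + y - (x + y')) = y - y' by ring.
have e2 : (x + y - (x' + y)) = x - x' by ring.
have e3 : (x' + y' - (x + y')) = - (x - x') by ring.
have e4 : (x' + y' - (x' + y)) = - (y - y') by ring.
rewrite e1 in h1; rewrite e2 in h2; rewrite e3 sqrrN in h3; rewrite e4 sqrrN in h4.
have p11 := sqr_ge0 (`|x + y| - m); have p12 := sqr_ge0 (`|x + y'| - m).
have p21 := sqr_ge0 (`|x' + y| - m); have p22 := sqr_ge0 (`|x' + y'| - m).
rewrite ge_min.
case: (leP 0 ((x + y) * (x + y'))) => [/h1 ?|k1].
  by apply/orP; right; lra.
case: (leP 0 ((x + y) * (x' + y))) => [/h2 ?|k2].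
  by apply/orP; left; lra.
case: (leP 0 ((x' + y') * (x + y'))) => [/h3 ?|k3].
  by apply/orP; left; lra.
case: (leP 0 ((x' + y') * (x' + y))) => [/h4 ?|k4].
  by apply/orP; right; lra.
(* If all four products were negative, so would be their sum, which factors as ((x+y) + (x'+y'))
   ((x+y') + (x'+y)). Both factors are equal, so this is a square. *)
by have := sqr_ge0 (x + y + (x' + y')); nra.
Qed.

(** Only |x - x'| > 4 m needs work. There |x - x'| <= |d| + |d'| + 2 m, and 2 m is at most half of
    the left side, so |x - x'| <= 2 (|d| + |d'|); squaring gives the factor 8. *)
Lemma sqr_sub_le_truncated (x x' y m : R) : 0 <= m ->
  (x - x') ^+ 2 <= Num.min ((x - x') ^+ 2) (16 * m ^+ 2) +
    8 * ((`|x + y| - m) ^+ 2 + (`|x' + y| - m) ^+ 2).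
Proof.
move=> m0; set d := `|x + y| - m; set d' := `|x' + y| - m.
have [h|h] := leP ((x - x') ^+ 2) (16 * m ^+ 2).
  by have := sqr_ge0 d; have := sqr_ge0 d'; lra.
have tri : `|x - x'| <= `|d| + `|d'| + 2 * m.
  have -> : x - x' = (x + y) - (x' + y) by ring.
  have := ler_normB (x + y) (x' + y).
  have := ler_norm d; have := ler_norm d'; rewrite /d /d'; lra.
have h4 : 4 * m <= `|x - x'|.
  rewrite leNgt; apply/negP => k.
  by move: h; rewrite -[(x - x') ^+ 2]real_normK ?num_real//;
    have := normr_ge0 (x - x'); nra.
have : `|x - x'| ^+ 2 <= (2 * (`|d| + `|d'|)) ^+ 2.
  by rewrite ler_sqr ?nnegrE//; have := normr_ge0 d; have := normr_ge0 d'; lra.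
rewrite real_normK ?num_real// -[d ^+ 2]real_normK ?num_real//.
rewrite -[d' ^+ 2]real_normK ?num_real//.
by have := sqr_ge0 (`|d| - `|d'|); have := sqr_ge0 m; nra.
Qed.

(** Whichever square attains the minimum in [min_sqr_sub_le], its truncation is at most that square
    and the other truncation is at most 16 m^2; 32 is 16 times 2. *)
Lemma mul_truncated_le (x x' y y' m : R) :
  Num.min ((x - x') ^+ 2) (16 * m ^+ 2) * Num.min ((y - y') ^+ 2) (16 * m ^+ 2)
  <= 32 * m ^+ 2 *
     ((`|x + y| - m) ^+ 2 + (`|x + y'| - m) ^+ 2 +
      (`|x' + y| - m) ^+ 2 + (`|x' + y'| - m) ^+ 2).
Proof.
have := min_sqr_sub_le x x' y y' m.
set s := (_ + _ + _ + _) => hs.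
set p := Num.min _ (16 * _); set q := Num.min _ (16 * _).
have p0 : 0 <= p by rewrite le_min sqr_ge0 mulr_ge0 ?sqr_ge0.
have q0 : 0 <= q by rewrite le_min sqr_ge0 mulr_ge0 ?sqr_ge0.
have pm : p <= 16 * m ^+ 2 by rewrite ge_min lexx orbT.
have qm : q <= 16 * m ^+ 2 by rewrite ge_min lexx orbT.
have px : p <= (x - x') ^+ 2 by rewrite ge_min lexx.
have qy : q <= (y - y') ^+ 2 by rewrite ge_min lexx.
have m0 := sqr_ge0 m.
move: hs; rewrite ge_min => /orP[] hs; nra.
Qed.

End pointwise.

(** * Independent pairs, Tonelli and averaging *)

Section independent_pair.
Local Open Scope classical_set_scope.
Local Open Scope ereal_scope.
Context {d} {T : measurableType d} {R : realType} (P : probability T R).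

Definition independent_pair {d1 d2} {T1 : measurableType d1}
    {T2 : measurableType d2} (X : T -> T1) (Y : T -> T2) :=
  forall A B, measurable A -> measurable B ->
  P (X @^-1` A `&` Y @^-1` B) = P (X @^-1` A) * P (Y @^-1` B).

Lemma independent_pair_sym {d1 d2} {T1 : measurableType d1}
    {T2 : measurableType d2} (X : T -> T1) (Y : T -> T2) :
  independent_pair X Y -> independent_pair Y X.
Proof. by move=> XY A B mA mB; rewrite setIC XY// muleC. Qed.

(** The joint law agrees with the product of the marginal laws on rectangles, hence everywhere, and
    Tonelli applies. The inner variable [w'] plays the part of an independent copy on the same
    space. *)
Lemma integral_independent_pair {d1 d2} {T1 : measurableType d1}
    {T2 : measurableType d2} (X : T -> T1) (Y : T -> T2) (f : T1 * T2 -> \bar R) :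
  measurable_fun [set: T] X -> measurable_fun [set: T] Y ->
  independent_pair X Y ->
  measurable_fun [set: T1 * T2] f -> (forall z, 0 <= f z) ->
  \int[P]_w f (X w, Y w) = \int[P]_w \int[P]_w' f (X w, Y w').
Proof.
move=> mX mY XY mf f0.
pose X' : {RV P >-> T1} := HB.pack X (isMeasurableFun.Build _ _ _ _ X mX).
pose Y' : {RV P >-> T2} := HB.pack Y (isMeasurableFun.Build _ _ _ _ Y mY).
pose Z := fun w => (X w, Y w).
have mZ : measurable_fun [set: T] Z by exact: measurable_fun_pair.
pose Z' : {RV P >-> (T1 * T2)%type} :=
  HB.pack Z (isMeasurableFun.Build _ _ _ _ Z mZ).
transitivity (\int[distribution P Z']_z f z).
  by rewrite ge0_integral_distribution.
transitivity (\int[distribution P X' \x distribution P Y']_z f z).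
  apply: eq_measure_integral => A mA _; apply/esym.
  by apply: product_measure_unique => // B C mB mC; exact: XY.
rewrite fubini_tonelli1// ge0_integral_distribution//.
- apply: eq_integral => w _ /=; rewrite /fubini_F.
  rewrite (@ge0_integral_distribution _ _ _ _ _ P Y' (fun y => f (X w, y)))//.
  by apply: measurableT_comp => //; exact: measurable_pair1.
- by apply: measurable_fun_fubini_tonelli_F.
- by move=> x; exact: integral_ge0.
Qed.

(** If f > c everywhere, then f - c is positive with integral at most 0, so it vanishes almost
    everywhere. The exceptional null set would then be the whole space, which has probability 1. *)
Lemma exists_le_integral (f : T -> \bar R) (c : R) :
  measurable_fun [set: T] f -> (forall w, 0 <= f w) ->
  \int[P]_w f w <= c%:E -> exists w, f w <= c%:E.
Proof.
move=> mf f0 fc; apply: contrapT => /forallNP fNc.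
have cf w : c%:E < f w by rewrite ltNge; apply/negP/fNc.
have intf : P.-integrable setT f.
  apply/integrableP; split=> //; under eq_integral do rewrite gee0_abs//.
  exact: le_lt_trans fc (ltry _).
have intc : P.-integrable setT (cst c%:E) by exact: finite_measure_integrable_cst.
have g0 w : 0 <= f w - c%:E by rewrite sube_ge0// ltW.
have : \int[P]_w `|f w - c%:E| = 0.
  under eq_integral do rewrite gee0_abs//.
  apply/eqP; rewrite eq_le integral_ge0// andbT.
  rewrite (integralB measurableT intf intc) integral_cst//= probability_setT mule1.
  by rewrite leeBlDr// add0e.
move/ae_eq_integral_abs => /(_ measurableT).
have mg : measurable_fun setT (fun w => f w - c%:E) by apply: emeasurable_funB.
move=> /(_ mg) [N [mN N0 subN]].
have NT : N = setT.
  apply/seteqP; split=> // w _; apply: subN => /= /(_ I) fw.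
  by have := cf w; rewrite -sube_gt0 fw ltxx.
have := probability_setT P; rewrite -NT.
by move: N0 => /= -> /eqP; rewrite eq_sym onee_eq0.
Qed.

End independent_pair.

(** * Second moments and variances *)

Section second_moments.
Local Open Scope classical_set_scope.
Local Open Scope ereal_scope.
Context {d} {T : measurableType d} {R : realType} (P : probability T R).
Implicit Types X Y : T -> R.

Lemma measurable_Lfun X p : X \in Lfun P p -> measurable_fun [set: T] X.
Proof. by rewrite inE => /andP[]; rewrite inE. Qed.

Lemma Lfun2_Lfun1 X : X \in Lfun P 2%:E -> X \in Lfun P 1.
Proof. by apply: Lfun_subset12; rewrite fin_num_measure. Qed.

Lemma Lfun2_norm X : X \in Lfun P 2%:E -> (fun w => `|X w|%R) \in Lfun P 2%:E.
Proof.
case/andP; rewrite !inE/= => mX finX; apply/andP; split.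
  by rewrite inE/=; exact: measurableT_comp.
rewrite inE/= /finite_norm.
under [X in ('N[_]__[X])%E]eq_fun => x do rewrite -abse_EFin.
by rewrite Lnorm_abse.
Qed.

(** Translation does not change the variance. Used with c zero, with c minus a centre, and with c
    the value of an independent variable. *)
Lemma integral_sqr_shift X (c : R) : X \in Lfun P 2%:E ->
  \int[P]_w ((X w + c) ^+ 2)%:E =
  (fine (variance P X) + (fine 'E_P[X] + c) ^+ 2)%:E.
Proof.
move=> X2; have X1 := Lfun2_Lfun1 X2.
have c2 : cst c \in Lfun P 2%:E by exact: Lfun_cst.
have Xc2 : (X \+ cst c)%R \in Lfun P 2%:E by rewrite rpredD ?lee1n.
have := varianceE Xc2; rewrite varianceD_cst_r// expectationD ?Lfun_cst//.
rewrite expectation_cst => VE.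
have -> : \int[P]_w ((X w + c) ^+ 2)%:E = 'E_P[((X \+ cst c) ^+ 2)%R].
  by rewrite unlock.
have V_fin := variance_fin_num X2; have E_fin := expectation_fin_num X1.
have E2_fin : ('E_P[X] + c%:E) ^+ 2 \is a fin_num.
  by rewrite fin_numX// fin_numD E_fin.
rewrite EFinD fineK// EFin_expe EFinD fineK//.
by rewrite VE subeK.
Qed.

Lemma integral_sqr X : X \in Lfun P 2%:E ->
  \int[P]_w (X w ^+ 2)%:E =
  (fine (variance P X) + fine 'E_P[X] ^+ 2)%:E.
Proof.
move=> X2; have := integral_sqr_shift 0 X2; rewrite addr0 => <-.
by apply: eq_integral => w _; rewrite addr0.
Qed.

Lemma variance_le_integral_sqr X (c : R) : X \in Lfun P 2%:E ->
  (fine (variance P X))%:E <= \int[P]_w ((X w - c) ^+ 2)%:E.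
Proof.
by move=> X2; rewrite integral_sqr_shift// lee_fin lerDl sqr_ge0.
Qed.

Lemma integral_centered_sqr X : X \in Lfun P 2%:E ->
  \int[P]_w ((X w - fine 'E_P[X]) ^+ 2)%:E = (fine (variance P X))%:E.
Proof. by move=> X2; rewrite integral_sqr_shift// subrr expr0n addr0. Qed.

Lemma variance_independent_add X Y :
  X \in Lfun P 2%:E -> Y \in Lfun P 2%:E -> independent_pair P X Y ->
  fine (variance P (X \+ Y)%R) =
  (fine (variance P X) + fine (variance P Y))%R.
Proof.
move=> X2 Y2 XY.
have XY2 : (X \+ Y)%R \in Lfun P 2%:E by rewrite rpredD ?lee1n.
have mX := measurable_Lfun X2; have mY := measurable_Lfun Y2.
have := integral_sqr XY2.
have /= -> := @integral_independent_pair _ _ _ P _ _ _ _ X Y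
  (fun z => ((z.1 + z.2) ^+ 2)%:E) mX mY XY _ _; last 2 first.
- apply/measurable_EFinP/measurable_funX/measurable_funD => //.
- by move=> z; rewrite lee_fin sqr_ge0.
(* With X frozen, integrating over Y gives Var Y + (X + E Y)^2; the shift formula then applies once
   more, to X. *)
under eq_integral => w _.
  under eq_integral do rewrite addrC.
  rewrite integral_sqr_shift// EFinD.
  over.
rewrite ge0_integralD//; last 3 first.
- by move=> w _; rewrite lee_fin fine_ge0// variance_ge0.
- by move=> w _; rewrite lee_fin sqr_ge0.
- by apply/measurable_EFinP/measurable_funX/measurable_funD.
under [X in _ + X]eq_integral do rewrite addrC.
rewrite integral_sqr_shift// integral_cst//= probability_setT mule1.
rewrite -EFinD => -[]; rewrite expectationD ?Lfun2_Lfun1//.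
rewrite fineD ?expectation_fin_num ?Lfun2_Lfun1//.
by move=> h; lra.
Qed.

End second_moments.

(** * The dichotomy for a sum of two independent variables *)

Section two_summands.
Local Open Scope classical_set_scope.
Local Open Scope ereal_scope.
Context {d} {T : measurableType d} {R : realType} (P : probability T R).
Variables X Y : T -> R.
Hypotheses (X2 : X \in Lfun P 2%:E) (Y2 : Y \in Lfun P 2%:E).
Hypothesis XY : independent_pair P X Y.

Let S w := (X w + Y w)%R.
Let m := fine 'E_P[fun w => `|S w|%R].
Let D := fine (variance P (fun w => `|S w|%R)).
Let h (x y : R) := ((`|x + y| - m) ^+ 2)%R.
Let trunc (x x' : R) := Num.min ((x - x') ^+ 2)%R (16 * m ^+ 2)%R.

Let mX : measurable_fun [set: T] X. Proof. exact: measurable_Lfun X2. Qed.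
Let mY : measurable_fun [set: T] Y. Proof. exact: measurable_Lfun Y2. Qed.

Let S2 : S \in Lfun P 2%:E.
Proof. by rewrite [S](_ : _ = X \+ Y)%R ?rpredD ?lee1n. Qed.

Let m_ge0 : (0 <= m)%R.
Proof. by apply: fine_ge0; apply: expectation_ge0. Qed.

Let D_ge0 : (0 <= D)%R.
Proof. by apply: fine_ge0; exact: variance_ge0. Qed.

(** |S| and S have the same second moment, and that of |S| exceeds [m ^+ 2] by the nonnegative
    variance of |S|. *)
Let sqr_m_le : (m ^+ 2 <= fine (variance P S) + fine 'E_P[S] ^+ 2)%R.
Proof.
rewrite -lee_fin -integral_sqr//.
under eq_integral do rewrite -real_normK ?num_real//.
by rewrite (integral_sqr (Lfun2_norm S2)) lee_fin lerDr.
Qed.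

Let h_ge0 x y : (0 <= h x y)%R. Proof. exact: sqr_ge0. Qed.

Let hC x y : h x y = h y x. Proof. by rewrite /h (addrC x). Qed.

Let measurable_h {d'} {T' : measurableType d'} (f g : T' -> R) :
  measurable_fun setT f -> measurable_fun setT g ->
  measurable_fun setT (fun w => (h (f w) (g w))%:E).
Proof.
move=> mf mg; apply/measurable_EFinP/measurable_funX/measurable_funB => //.
by apply: measurableT_comp => //; exact: measurable_funD.
Qed.

Let integral_h : \int[P]_w (h (X w) (Y w))%:E = D%:E.
Proof. exact: integral_centered_sqr (Lfun2_norm S2). Qed.

(** Evaluated at x' = X w and y' = Y w for one common w, each of the three terms has mean D, the
    first two by independence. Some w does no worse than the average 3 D. *)
Let exists_good_point : exists x' y' : R,
  \int[P]_w (h x' (Y w))%:E + \int[P]_w (h (X w) y')%:E + (h x' y')%:E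
  <= (3 * D)%:E.
Proof.
pose D1 w := \int[P]_w' (h (X w) (Y w'))%:E.
pose D2 w := \int[P]_w' (h (X w') (Y w))%:E.
have mD1 : measurable_fun setT D1.
  apply: (@measurable_fun_fubini_tonelli_F _ _ _ _ _ P
    (fun z : T * T => (h (X z.1) (Y z.2))%:E)) => [|z]; last by rewrite lee_fin.
  by apply: measurable_h; exact: measurableT_comp.
have mD2 : measurable_fun setT D2.
  apply: (@measurable_fun_fubini_tonelli_F _ _ _ _ _ P
    (fun z : T * T => (h (X z.2) (Y z.1))%:E)) => [|z]; last by rewrite lee_fin.
  by apply: measurable_h; exact: measurableT_comp.
have D1_ge0 w : 0 <= D1 w by apply: integral_ge0 => ? _; rewrite lee_fin.
have D2_ge0 w : 0 <= D2 w by apply: integral_ge0 => ? _; rewrite lee_fin.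
have iD1 : \int[P]_w D1 w = D%:E.
  rewrite -integral_h.
  rewrite (@integral_independent_pair _ _ _ P _ _ _ _ X Y
    (fun z => (h z.1 z.2)%:E))// => [|z]; last by rewrite lee_fin.
  exact: measurable_h.
have iD2 : \int[P]_w D2 w = D%:E.
  rewrite -integral_h.
  rewrite (@integral_independent_pair _ _ _ P _ _ _ _ Y X
    (fun z => (h z.2 z.1)%:E))// => [||z]; last by rewrite lee_fin.
    exact: independent_pair_sym.
  exact: measurable_h.
have [|||w hw] := @exists_le_integral _ _ _ P
    (fun w => D1 w + D2 w + (h (X w) (Y w))%:E) (3 * D) _ _ _; last 1 first.
- by exists (X w), (Y w).
- apply: emeasurable_funD; first exact: emeasurable_funD.
  exact: measurable_h.
- by move=> w; apply: adde_ge0; [exact: adde_ge0|rewrite lee_fin].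
- rewrite ge0_integralD//; last 4 first.
  + by move=> w _; rewrite adde_ge0.
  + exact: emeasurable_funD.
  + by move=> w _; rewrite lee_fin.
  + exact: measurable_h.
  rewrite ge0_integralD// iD1 iD2 integral_h -!EFinD lee_fin.
  by lra.
Qed.

Let measurable_trunc (f : T -> R) x' : measurable_fun setT f ->
  measurable_fun setT (fun w => trunc (f w) x').
Proof.
move=> mf; apply: measurable_minr => //.
by apply/measurable_funX/measurable_funB.
Qed.

Let trunc_ge0 x x' : (0 <= trunc x x')%R.
Proof. by rewrite le_min sqr_ge0 mulr_ge0 ?sqr_ge0. Qed.

Let integral_trunc_fin (f : T -> R) x' : measurable_fun setT f ->
  \int[P]_w (trunc (f w) x')%:E \is a fin_num.
Proof.
move=> mf; rewrite ge0_fin_numE; last first.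
  by apply: integral_ge0 => w _; rewrite lee_fin.
apply: (@le_lt_trans _ _ (\int[P]_w (cst (16 * m ^+ 2)%:E w))).
  apply: ge0_le_integral => //.
  - by move=> w _; rewrite lee_fin.
  - exact/measurable_EFinP/measurable_trunc.
  - by move=> w _; rewrite lee_fin ge_min lexx orbT.
by rewrite integral_cst//= probability_setT mule1 ltry.
Qed.

(** Integrates [sqr_sub_le_truncated] after bounding the variance by the second moment about x'.
    Kept general in U and W so as to serve both (X, Y) and (Y, X). *)
Let variance_le_trunc (U W : T -> R) x' : U \in Lfun P 2%:E ->
  measurable_fun setT W -> \int[P]_w (h (U w) (W w))%:E = D%:E ->
  (fine (variance P U))%:E <= \int[P]_w (trunc (U w) x')%:E +
    8%:E * (D%:E + \int[P]_w (h x' (W w))%:E).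
Proof.
move=> U2 mW <-; have mU := measurable_Lfun U2.
apply: (le_trans (variance_le_integral_sqr x' U2)).
have hE x y : 0 <= (h x y)%:E by rewrite lee_fin.
have tE x : 0 <= (trunc x x')%:E by rewrite lee_fin.
have mh1 : measurable_fun setT (fun w => (h (U w) (W w))%:E) by exact: measurable_h.
have mh2 : measurable_fun setT (fun w => (h x' (W w))%:E) by exact: measurable_h.
have mt : measurable_fun setT (fun w => (trunc (U w) x')%:E).
  exact/measurable_EFinP/measurable_trunc.
have hh w : 0 <= (h (U w) (W w))%:E + (h x' (W w))%:E by rewrite adde_ge0.
have mhh := emeasurable_funD mh1 mh2.
rewrite -ge0_integralD// -ge0_integralZl// -ge0_integralD//; last 2 first.
- by move=> w _; rewrite mule_ge0.
- exact: emeasurable_funM.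
apply: ge0_le_integral => //.
- by move=> w _; rewrite lee_fin sqr_ge0.
- by apply/measurable_EFinP/measurable_funX/measurable_funB.
- by apply: emeasurable_funD => //; exact: emeasurable_funM.
- by move=> w _; rewrite -!EFinD lee_fin; exact: sqr_sub_le_truncated.
Qed.

(** Independence turns the product of integrals into the integral of the product, to which
    [mul_truncated_le] applies pointwise. *)
Let mul_trunc_le x' y' :
  \int[P]_w (trunc (X w) x')%:E * \int[P]_w (trunc (Y w) y')%:E <=
  (32 * m ^+ 2)%:E * (D%:E + \int[P]_w (h (X w) y')%:E +
    \int[P]_w (h x' (Y w))%:E + (h x' y')%:E).
Proof.
have -> : \int[P]_w (trunc (X w) x')%:E * \int[P]_w (trunc (Y w) y')%:E =
    \int[P]_w (trunc (X w) x' * trunc (Y w) y')%:E.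
  rewrite (@integral_independent_pair _ _ _ P _ _ _ _ X Y
    (fun z => (trunc z.1 x' * trunc z.2 y')%:E))//; last 2 first.
  - apply/measurable_EFinP/measurable_funM; apply: measurable_minr => //;
      by apply/measurable_funX/measurable_funB.
  - by move=> z; rewrite lee_fin mulr_ge0.
  rewrite muleC -ge0_integralZl//; last 3 first.
  - exact/measurable_EFinP/measurable_trunc.
  - by move=> w _; rewrite lee_fin.
  - by apply: integral_ge0 => w _; rewrite lee_fin.
  apply: eq_integral => w _; rewrite muleC -ge0_integralZl//.
  - exact/measurable_EFinP/measurable_trunc.
  - by move=> w' _; rewrite lee_fin.
  - by rewrite lee_fin.
have -> : (h x' y')%:E = \int[P]_w cst (h x' y')%:E w.
  by rewrite integral_cst//= probability_setT mule1.
have mh1 : measurable_fun setT (fun w => (h (X w) (Y w))%:E) by exact: measurable_h.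
have mh2 : measurable_fun setT (fun w => (h (X w) y')%:E) by exact: measurable_h.
have mh3 : measurable_fun setT (fun w => (h x' (Y w))%:E) by exact: measurable_h.
have hE x y : 0 <= (h x y)%:E by rewrite lee_fin.
have c0 : (0 <= 32 * m ^+ 2)%R by rewrite mulr_ge0 ?sqr_ge0.
have h12 w : 0 <= (h (X w) (Y w))%:E + (h (X w) y')%:E by rewrite adde_ge0.
have mh12 := emeasurable_funD mh1 mh2.
have h123 w : 0 <= (h (X w) (Y w))%:E + (h (X w) y')%:E + (h x' (Y w))%:E.
  by rewrite adde_ge0.
have mh123 := emeasurable_funD mh12 mh3.
have h1234 w : 0 <= (h (X w) (Y w))%:E + (h (X w) y')%:E + (h x' (Y w))%:E +
    cst (h x' y')%:E w by rewrite adde_ge0// lee_fin.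
have mc : measurable_fun setT (cst (h x' y')%:E : T -> \bar R) by [].
have mh1234 := emeasurable_funD mh123 mc.
rewrite -integral_h -ge0_integralD// -ge0_integralD// -ge0_integralD//; last first.
  by move=> w _; exact: hE.
rewrite -ge0_integralZl//.
apply: ge0_le_integral => //.
- by move=> w _; rewrite lee_fin mulr_ge0.
- by apply/measurable_EFinP/measurable_funM; exact: measurable_trunc.
- exact: emeasurable_funM.
- by move=> w _; rewrite -!EFinD lee_fin; exact: mul_truncated_le.
Qed.

Lemma variance_norm_add_dichotomy :
  let VX := fine (variance P X) in let VY := fine (variance P Y) in
  let M := (fine (variance P (X \+ Y)%R) + fine 'E_P[(X \+ Y)%R] ^+ 2)%R in
  let V := fine (variance P (fun w => `|(X \+ Y)%R w|%R)) in
  (Num.min VX VY < 64 * V)%R \/ (VX * VY <= 512 * M * V)%R.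
Proof.
move=> VX VY M V; have -> : V = D by [].
have [x' [y' good]] := exists_good_point.
have i_ge0 (f : T -> R) : (forall w, (0 <= f w)%R) -> 0 <= \int[P]_w (f w)%:E.
  by move=> f0; apply: integral_ge0 => w _; rewrite lee_fin.
have i1_ge0 := i_ge0 _ (fun w => h_ge0 x' (Y w)).
have i2_ge0 := i_ge0 _ (fun w => h_ge0 (X w) y').
have i1_fin : \int[P]_w (h x' (Y w))%:E \is a fin_num.
  rewrite ge0_fin_numE//; apply: le_lt_trans (ltry (3 * D)%R).
  by apply: le_trans good; rewrite -addeA leeDl// adde_ge0 ?lee_fin//.
have i2_fin : \int[P]_w (h (X w) y')%:E \is a fin_num.
  rewrite ge0_fin_numE//; apply: le_lt_trans (ltry (3 * D)%R).
  apply: le_trans good; rewrite (addeC (\int[P]_w _)) -addeA leeDl//.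
  by rewrite adde_ge0 ?lee_fin.
have iYX : \int[P]_w (h (Y w) (X w))%:E = D%:E.
  by rewrite -integral_h; apply: eq_integral => w _; rewrite hC.
have bX := @variance_le_trunc X Y x' X2 mY integral_h.
have := @variance_le_trunc Y X y' Y2 mX iYX.
under [X in _ + _ * (_ + X)]eq_integral do rewrite hC.
move=> bY; have bXY := mul_trunc_le x' y'.
have pX := i_ge0 _ (fun w => trunc_ge0 (X w) x').
have pY := i_ge0 _ (fun w => trunc_ge0 (Y w) y').
move: good bX bY bXY pX pY i1_ge0 i2_ge0.
rewrite -(fineK (integral_trunc_fin x' mX)) -(fineK (integral_trunc_fin y' mY)).
rewrite -(fineK i1_fin) -(fineK i2_fin).
move: (fine _) (fine (\int[P]_w (h _ y')%:E)) => e1 e2.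
move: (fine (\int[P]_w (trunc _ x')%:E)) (fine (\int[P]_w (trunc _ y')%:E)) => p q.
rewrite -!EFinD -!EFinM !lee_fin -/VX -/VY.
move: (h_ge0 x' y') sqr_m_le (sqr_ge0 m) D_ge0.
have -> : (fine (variance P S) + fine 'E_P[S] ^+ 2)%R = M by [].
move: (h x' y') (m ^+ 2)%R D => e3 m2 D' e3_ge0 m2M m2_ge0 D'_ge0.
move=> good bX bY bpq p0 q0 e10 e20.
have [?|] := ltP (Num.min VX VY) (64 * D')%R; first by left.
rewrite le_min => /andP[kX kY]; right.
(* By [good] the integral of h(x', Y) is at most 3 D', so VX <= p + 8 (D' + 3 D') = p + 32 D'. As VX
   >= 64 D', the last term is at most VX / 2. *)
have hp : (VX <= 2 * p)%R by lra.
have hq : (VY <= 2 * q)%R by lra.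
(* The four terms in [bpq] total at most D' + 3 D', and 32 times 4 is 128; the factors 2 in [hp] and
   [hq] raise this to 512. *)
have pq : (p * q <= 128 * m2 * D')%R.
  by apply: (le_trans bpq); nra.
have : (VX * VY <= (2 * p) * (2 * q))%R by apply: ler_pM => //; lra.
have : (m2 * D' <= M * D')%R by apply: ler_wpM2r.
by lra.
Qed.

End two_summands.

(** * Independence of sums over disjoint blocks *)

Section block_sums.
Local Open Scope classical_set_scope.
Local Open Scope ereal_scope.
Context {d} {T : measurableType d} {R : realType} (P : probability T R).
Context {n : nat} (X : 'I_n -> {RV P >-> R}).
Implicit Types J K : {set 'I_n}.

(** A pi-system generating the sigma-algebra of the variables indexed by J. *)
Definition cylinders J : set (set T) :=
  [set C | exists2 B : 'I_n -> set R, (forall i, measurable (B i)) &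
           C = \bigcap_(i in [set` J]) (X i @^-1` B i)].

Lemma setI_closed_cylinders J : setI_closed (cylinders J).
Proof.
move=> _ _ [A mA ->] [B mB ->]; exists (fun i => A i `&` B i).
  by move=> i; exact: measurableI.
by apply/seteqP; split=> [w [wA wB] i Ji|w wAB]; [split; [exact: wA|exact: wB]|
  split=> i Ji; have [] := wAB i Ji].
Qed.

Lemma cylinders_setT J : cylinders J setT.
Proof. by exists (fun=> setT) => //; apply/seteqP; split. Qed.

Lemma measurable_cylinders J : cylinders J `<=` measurable.
Proof.
move=> _ [B mB ->]; apply: fin_bigcap_measurable => // i _.
exact: measurable_funPTI.
Qed.

Lemma measurable_generated_cylinders J : <<s cylinders J >> `<=` measurable.
Proof.
apply: smallest_sub; first exact: sigma_algebra_measurable.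
exact: measurable_cylinders.
Qed.

Definition block_sum J (w : T) : R := (\sum_(i in J) X i w)%R.

(** T is given the coarser sigma-algebra generated by the cylinders: each X i with i in J is
    measurable for it, hence so is their sum. *)
Lemma generated_block_sum J (B : set R) : measurable B ->
  <<s cylinders J >> (block_sum J @^-1` B).
Proof.
move=> mB; pose TJ := g_sigma_algebraType (cylinders J).
have mX i : i \in J -> measurable_fun (setT : set TJ) (X i : TJ -> R).
  move=> iJ _ A mA; rewrite setTI; apply: sub_sigma_algebra.
  exists (fun j => if j == i then A else setT) => [j|]; first by case: ifP.
  apply/seteqP; split=> [w wA j jJ|w /(_ i iJ)]; last by rewrite eqxx.
  by case: eqP => [->|].
have mS : measurable_fun (setT : set TJ) (block_sum J : TJ -> R).
  rewrite (_ : block_sum J =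
      fun w => (\sum_(i <- enum 'I_n) (if i \in J then X i w else 0))%R); last first.
    by apply/funext => w; rewrite /block_sum big_mkcond big_enum.
  apply: measurable_sum => i.
  by have [iJ|_] := boolP (i \in J); [exact: mX|exact: measurable_cst].
by have := mS measurableT _ mB; rewrite setTI.
Qed.

Hypothesis X_indep : mutually_independent X.

(** By disjointness the two families of sets merge into one family over the union of J and K, whose
    product of probabilities splits. *)
Lemma independent_cylinders J K A B : [disjoint J & K]%B ->
  cylinders J A -> cylinders K B -> P (A `&` B) = P A * P B.
Proof.
move=> JK [a ma ->] [b mb ->].
rewrite !X_indep//.
pose c i := if i \in J then a i else b i.
rewrite [X in P X](_ : _ = \bigcap_(i in [set` J :|: K]) (X i @^-1` c i)); last first.
  apply/seteqP; split=> [w [wa wb] i /=|w wc].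
    rewrite inE /c; case: ifP => iJ /=; first by move=> _; exact: wa.
    exact: wb.
  split=> i /= iJ.
    by have := wc i; rewrite /= inE /c iJ; exact.
  have := wc i; rewrite /= inE /c iJ orbT ifN; first exact.
  by apply/negP => /(disjointFr JK); rewrite iJ.
rewrite X_indep; last by move=> i; rewrite /c; case: ifP.
transitivity (\prod_(i in [predU J & K]) P (X i @^-1` c i)).
  by apply: eq_bigl => i; rewrite !inE.
rewrite bigU//=; congr (_ * _); apply: eq_bigr => i iJ; rewrite /c ?iJ//.
by rewrite ifN//; apply/negP => /(disjointFr JK); rewrite iJ.
Qed.

(** A -> P (A [&] B) and A -> P A * P B are finite measures agreeing on the pi-system G, hence on
    the sigma-algebra it generates. *)
Let extend_independence (G : set (set T)) (B : set T) :
  G `<=` measurable -> setI_closed G -> G setT -> measurable B ->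
  (forall A, G A -> P (A `&` B) = P A * P B) ->
  forall A, <<s G >> A -> P (A `&` B) = P A * P B.
Proof.
move=> mG GI GT mB GB A sA.
have PB : P B \is a fin_num by exact: fin_num_measure.
have PB0 : (0 <= fine (P B))%R by exact: fine_ge0.
have scaleE C : mscale (NngNum PB0) P C = P C * P B.
  by rewrite muleC; congr (_ * _); exact: fineK.
rewrite -scaleE.
apply: (@g_sigma_algebra_measure_unique _ R _ G mG (fun=> setT) (fun=> GT) _
  (mrestr P mB) (mscale (NngNum PB0) P) GI) => //.
- by apply/seteqP; split=> // w _; exists 0%N.
- by move=> C GC; rewrite [RHS]scaleE -GB.
- by move=> _; change (P (setT `&` B) < +oo); rewrite setTI -ge0_fin_numE.
Qed.

Lemma independent_block_sums J K : [disjoint J & K]%B ->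
  independent_pair P (block_sum J) (block_sum K).
Proof.
move=> JK A B mA mB.
have sA := generated_block_sum (J := J) mA.
have sB := generated_block_sum (J := K) mB.
apply: (extend_independence (@measurable_cylinders J)
  (@setI_closed_cylinders J) (cylinders_setT J)) => //.
  exact: measurable_generated_cylinders sB.
(* The first side is now reduced to a cylinder C; with C fixed, the same extension handles the
   second side. *)
move=> C GC; rewrite setIC muleC.
apply: (extend_independence (@measurable_cylinders K)
  (@setI_closed_cylinders K) (cylinders_setT K)) => //.
  exact: measurable_cylinders GC.
move=> E GE; apply: independent_cylinders GE GC.
by rewrite disjoint_sym.
Qed.

Hypothesis X_L2 : forall i, (X i : T -> R) \in Lfun P 2%:E.

Lemma block_sum_Lfun2 J : block_sum J \in Lfun P 2%:E.
Proof.
rewrite (_ : block_sum J = (\sum_(i in J) (X i : T -> R))%R); last first.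
  by apply/funext => w; rewrite /block_sum fct_sumE.
by rewrite rpred_sum// ?lee1n.
Qed.

Lemma block_sumU J K : [disjoint J & K]%B ->
  block_sum (J :|: K) = (block_sum J \+ block_sum K)%R.
Proof.
move=> JK; apply/funext => w; rewrite /block_sum /=.
transitivity (\sum_(i in [predU J & K]) X i w)%R; last by rewrite bigU.
by apply: eq_bigl => i; rewrite !inE.
Qed.

Lemma variance_block_sumU J K : [disjoint J & K]%B ->
  fine (variance P (block_sum (J :|: K))) =
  (fine (variance P (block_sum J)) + fine (variance P (block_sum K)))%R.
Proof.
move=> JK; rewrite block_sumU// variance_independent_add ?block_sum_Lfun2//.
exact: independent_block_sums.
Qed.

End block_sums.

(** * Balanced splitting and the final bound *)

(* Either one point carries a third of the total weight, or greedily adding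
   points reaches a weight between one and two thirds. *)
Lemma balanced_split (R : realType) (n : nat) (W : {set 'I_n} -> R) :
  (0 < n)%N -> (forall J, 0 <= W J) ->
  (forall J K : {set 'I_n}, [disjoint J & K] -> W (J :|: K) = W J + W K) ->
  exists (k : 'I_n) (J : {set 'I_n}), W (~: [set k]) <= 3 * Num.min (W J) (W (~: J)).
Proof.
move=> n_gt0 W_ge0 WU; pose V := W [set: 'I_n].
have WC J : W J + W (~: J) = V.
  by rewrite -WU ?finset.setUCr// -setI_eq0 finset.setICr.
have W0 : W finset.set0 = 0.
  have := WU finset.set0 finset.set0; rewrite finset.setU0 => W00.
  suff /W00 : [disjoint (finset.set0 : {set 'I_n}) & finset.set0] by lra.
  by rewrite -finset.setI_eq0 finset.setI0.
have [[k hk]|small] := pselect (exists k, V / 3 <= W [set k]).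
  exists k, [set k]; have := WC [set k]; have := W_ge0 (~: [set k]).
  have := W_ge0 [set k].
  by move=> *; rewrite minr_pMr// le_min; apply/andP; split; lra.
have {}small k : W [set k] < V / 3.
  by rewrite ltNge; apply/negP => hk; apply: small; exists k.
pose pre (j : nat) : {set 'I_n} := [set i : 'I_n | (i < j)%N].
have pren : pre n = [set: 'I_n] by apply/setP => i; rewrite !inE ltn_ord.
have V_ge0 : 0 <= V := W_ge0 _.
have ex : exists j, V / 3 <= W (pre j) by exists n; rewrite pren -/V; lra.
(* Any index would do here: both sides of the split will weigh at least V / 3, while removing a
   point leaves at most V. *)
exists (Ordinal n_gt0).
exists (pre (ex_minn ex)); case: ex_minnP => j hj jmin.
(* By minimality of j the previous prefix weighs less than V / 3, and so does the added point. *)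
have hj3 : W (pre j) <= 2 * V / 3.
  case: j hj jmin => [|j] hj jmin.
    rewrite (_ : pre 0%N = finset.set0) ?W0; last by apply/setP => i; rewrite !inE.
    by lra.
  have hlt : W (pre j) < V / 3.
    by rewrite ltNge; apply/negP => /jmin; rewrite ltnn.
  have [jn|nj] := ltnP j n; last first.
    rewrite (_ : pre j.+1 = pre j) ?ltW//; first by lra.
    by apply/setP => i; rewrite !inE ltnS ltnW// (leq_trans (ltn_ord i)).
  rewrite (_ : pre j.+1 = pre j :|: [set Ordinal jn]); last first.
    by apply/setP => i; rewrite !inE ltnS leq_eqVlt orbC -val_eqE.
  rewrite WU; first by have := small (Ordinal jn); lra.
  by rewrite disjoint_sym disjoints1 !inE ltnn.
have := WC (pre j); have := WC [set Ordinal n_gt0].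
have := W_ge0 [set Ordinal n_gt0].
by move=> *; rewrite minr_pMr// le_min; apply/andP; split; lra.
Qed.

(** The sum is at most twice the maximum, and maximum times minimum is a b. *)
Lemma addr_mul_min_le (R : realType) (a b : R) : 0 <= a -> 0 <= b ->
  (a + b) * Num.min a b <= 2 * (a * b).
Proof. by move=> a0 b0; have [ab|ba] := leP a b; nra. Qed.

Theorem theorem1 (R : realType) :
  exists K2 : R, 0 < K2 /\ K2 <= 61440%:R /\
  forall (d : measure_display) (T : measurableType d) (P : probability T R)
         (n : nat) (X : 'I_n -> {RV P >-> R}),
    mutually_independent X ->
    (forall i, (X i : T -> R) \in Lfun P 2%:E) ->
    let E := fine ('E_P[sumRV (fun i => X i : T -> R)]) in
    let V := fine (variance P (sumRV (fun i => X i : T -> R))) in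
    0 < V + E ^+ 2 ->
    exists k : 'I_n,
      fine (variance P (fun w => `|sumRV (fun i => X i : T -> R) w|))
      >= V * fine (variance P (sumRV_but (fun i => X i : T -> R) k))
           / (K2 * (V + E ^+ 2)).
Proof.
exists 61440%:R; split; first by rewrite ltr0n.
split=> // d T P n X X_indep X_L2 E V M_gt0.
(* The empty sum is zero, which contradicts V + E^2 > 0. *)
have n_gt0 : (0 < n)%N.
  case: n X X_indep X_L2 @E @V M_gt0 => // X _ _ E V.
  have S0 : sumRV (fun i => X i : T -> R) = cst 0.
    by apply/funext => w; rewrite /sumRV big_ord0.
  by rewrite /V /E S0 variance_cst expectation_cst/= expr0n addr0 ltxx.
pose W J := fine (variance P (block_sum X J)).
have W_ge0 J : 0 <= W J by apply: fine_ge0; exact: variance_ge0.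
have WU (J K : {set 'I_n}) : [disjoint J & K] -> W (J :|: K) = W J + W K.
  exact: variance_block_sumU.
have [k [J hk]] := balanced_split n_gt0 W_ge0 WU.
exists k.
have -> : sumRV_but (fun i => X i : T -> R) k = block_sum X (~: [set k]).
  by apply/funext => w; apply: eq_bigl => i; rewrite !inE.
rewrite -/(W _); have JC : [disjoint J & ~: J].
  by rewrite -finset.setI_eq0 finset.setICr.
have SE : sumRV (fun i => X i : T -> R) = (block_sum X J \+ block_sum X (~: J)).
  rewrite -block_sumU// finset.setUCr.
  by apply/funext => w; apply: eq_bigl => i; rewrite inE.
have VE : V = W J + W (~: J) by rewrite -WU// /V SE /W block_sumU.
have := variance_norm_add_dichotomy (block_sum_Lfun2 X_L2 J)
  (block_sum_Lfun2 X_L2 (~: J)) (independent_block_sums X_indep JC).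
rewrite -SE -/(W J) -/(W (~: J)) -/V -/E.
set D := fine _ => /= dich.
have D_ge0 : 0 <= D by apply: fine_ge0; exact: variance_ge0.
rewrite ler_pdivrMr ?mulr_gt0// ?ltr0n//.
set M := V + E ^+ 2 in M_gt0 dich *.
have VM : V <= M by rewrite lerDl sqr_ge0.
set a := W J in hk VE dich; set b := W (~: J) in hk VE dich.
have a_ge0 : 0 <= a := W_ge0 J; have b_ge0 : 0 <= b := W_ge0 (~: J).
have V_ge0 : 0 <= V by rewrite VE addr_ge0.
set mn := Num.min a b in hk dich.
have mn_ge0 : 0 <= mn by rewrite le_min a_ge0.
have Vmn : V * mn <= 2 * (a * b).
  by rewrite VE; exact: addr_mul_min_le.
have VW : V * W (~: [set k]) <= 3 * (V * mn).
  by rewrite mulrCA ler_wpM2l.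
have MD_ge0 : 0 <= M * D by rewrite mulr_ge0// ltW.
(* Together with [VW] this gives the constant 3072 = 3 * 1024, below 61440. Here 1024 = 2 * 512
   comes from the product branch of [dich]; the other branch needs only 64, by V <= M. *)
suff VmnMD : V * mn <= 1024 * (M * D).
  have K_ge : 3072%:R <= 61440%:R :> R by rewrite ler_nat.
  have := ler_wpM2r MD_ge0 K_ge; move: (61440%:R) => K.
  by lra.
case: dich => [lt64|ab]; last by lra.
have : V * mn <= M * (64 * D).
  by apply: ler_pM => //; exact: ltW.
lra.
Qed.
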